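(* Let $n \ge 4$ and let $f : [1,\infty) \to \mathbb{R}^+$ be a function such that $\log f$ is convex. Then for every unicyclic graph $G$ with $n$ vertices, $$ f(2)^n \le II_f(G) \le f(n-1)\, f(2)^2 f(1)^{n-3}, $$ and both inequalities are attained (i.e., for each such $n$ and $f$, each of the two bounds is equal to $II_f(G)$ for some unicyclic graph $G$ with $n$ vertices).
   Context: All graphs are finite, connected, simple (no loops, no multiple edges) and have at least one edge. A unicyclic graph is a graph containing exactly one cycle. For a vertex $u$ of $G$, $d_u$ denotes its degree. $\mathbb{R}^+$ denotes the positive real numbers. For a function $f:[1,\infty)\to\mathbb{R}^+$, $II_f(G) = \prod_{u\in V(G)} f(d_u)$. *)

(* Defs.v *)
From mathcomp Require Import all_boot all_order all_algebra.
From mathcomp Require Import all_classical all_reals all_analysis.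

Set Implicit Arguments.
Unset Strict Implicit.
Unset Printing Implicit Defensive.

Import Order.TTheory GRing.Theory Num.Theory.

Local Open Scope ring_scope.

Record graph := Graph {
  vertex :> finType;
  adj : rel vertex;
  adj_sym : symmetric adj;
  adj_irrefl : irreflexive adj;
  adj_connected : forall x y : vertex, connect adj x y;
  adj_nonempty : exists x y : vertex, adj x y
}.

Definition deg (G : graph) (u : G) : nat := #|[set v : G | adj u v]|.

(* A cycle of G is a subgraph, so the different ways of listing its vertices
   (rotations, reversal) must be identified: it is represented by its set of
   edges, an edge being the set of its two endpoints. *)
Definition cycle_edges (G : graph) (c : seq G) : {set {set G}} :=
  [set [set x; next c x] | x in c].

(* The bound on the size is needed because [ucycle] also holds of the empty
   sequence and of [:: x; y] for every edge xy. *)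
Definition is_cycle (G : graph) (C : {set {set G}}) : Prop :=
  exists c : seq G,
    [/\ ucycle (@adj G) c, (3 <= size c)%N & C = cycle_edges c].

Definition unicyclic (G : graph) : Prop :=
  exists! C : {set {set G}}, is_cycle C.

Definition II (R : realType) (f : R -> R) (G : graph) : R :=
  \prod_(u : G) f (deg u)%:R.

(* Main.v *)
Require Import Defs.
From mathcomp Require Import all_boot all_order all_algebra.
From mathcomp Require Import all_classical all_reals all_analysis.
From mathcomp Require Import zify lra.

Set Implicit Arguments.
Unset Strict Implicit.
Unset Printing Implicit Defensive.

Import Order.TTheory GRing.Theory Num.Theory.

Local Open Scope ring_scope.

(** Write h = ln f.  In a unicyclic graph a spanning tree misses exactly one
    edge: each missed edge closes a cycle whose other edges lie in the tree, so
    two missed edges would give two cycles, and a tree contains no cycle.  Hence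
    the n degrees, all at least 1, sum to 2n.  The lower bound follows by summing
    the tangent inequality h(d) >= h(2) + (d - 2)(h(3) - h(2)).  For the upper
    bound, the cycle provides three vertices of degree at least 2; setting
    e = (2, 2, 2, 1, ..., 1), the excesses d - e sum to n - 3, and by convexity
    transferring all of them to a single vertex with e = 2 can only increase the
    sum of the h(d).  The bounds are attained by the n-cycle and by the star
    with one additional edge. *)

(** * Convex sequences *)

Section ConvexSequences.
Variables (R : realFieldType) (h : nat -> R).
Hypothesis h_convex :
  forall i, (1 <= i)%N -> h i.+1 + h i.+1 <= h i + h i.+2.

(** By convexity the increments [h i.+1 - h i] are nondecreasing for [i >= 1]; both sides add up [k]
    of them, starting at [a] and at [b]. *)
Lemma convex_seq_shift a b k : (1 <= a <= b)%N ->
  h (a + k)%N - h a <= h (b + k)%N - h b.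
Proof.
have step i m : (1 <= i)%N -> h i.+1 - h i <= h (i + m).+1 - h (i + m)%N.
  move=> i1; elim: m => [|m IH]; first by rewrite addn0.
  have := @h_convex (i + m)%N (leq_trans i1 (leq_addr _ _)).
  rewrite addnS; lra.
case/andP=> a1 /subnKC <-; set m := (b - a)%N.
elim: k => [|k IH]; first by rewrite !addn0 !subrr.
have := step (a + k)%N m (leq_trans a1 (leq_addr _ _)).
rewrite (addnAC a k m) !addnS; lra.
Qed.

(** The line through the points at 2 and 3 stays below [h]: increments after 2 are at least
    [h 3 - h 2], and the one before is at most that. *)
Lemma convex_seq_tangent2 d : (1 <= d)%N ->
  h 2 + (d%:R - 2) * (h 3 - h 2) <= h d.
Proof.
case: d => [|[|d]] // _.
  have := @h_convex 1 isT; lra.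
elim: d => [|d IH]; first by rewrite subrr mul0r addr0.
move: IH; have := @convex_seq_shift 2 d.+2 1 isT.
rewrite !addn1 -[in d.+3%:R]natr1; lra.
Qed.

Lemma convex_seq_sum_lower (T : finType) (d : T -> nat) :
  (forall u, (1 <= d u)%N) -> (\sum_u d u = #|T|.*2)%N ->
  h 2 *+ #|T| <= \sum_u h (d u).
Proof.
move=> d1 sd.
(* The average of [d] is 2, so the slope terms cancel in the sum. *)
suff -> : h 2 *+ #|T| = \sum_(u : T) (h 2 + ((d u)%:R - 2) * (h 3 - h 2)).
  by apply: ler_sum => u _; exact: convex_seq_tangent2.
rewrite big_split /= sumr_const -mulr_suml sumrB sumr_const.
by rewrite -natr_sum sd -muln2 natrM -[2 *+ _]mulr_natl subrr mul0r addr0.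
Qed.

(** The excesses are moved one vertex at a time onto an accumulator that starts at 2. Since
    [e u <= 2], the accumulator is never below [e u], so [convex_seq_shift] shows that each move
    does not lower the total. *)
Lemma convex_seq_sum_upper (T : finType) (e k : T -> nat) :
  (forall u, (1 <= e u <= 2)%N) ->
  \sum_u h (e u + k u)%N + h 2 <= \sum_u h (e u) + h (2 + \sum_u k u)%N.
Proof.
move=> e12.
apply: (big_rec3 (fun x y n => x + h 2 <= y + h (2 + n)%N)) => // u x y n _.
have := @convex_seq_shift (e u) (2 + n)%N (k u) _.
have -> : (1 <= e u <= 2 + n)%N.
  by have/andP[-> /leq_trans->] := e12 u; rewrite ?leq_addr.
rewrite addnAC addnA addnAC => /(_ isT); lra.
Qed.

End ConvexSequences.

Lemma convex_function_midpoint (R : realType) (g : R -> R) (i : nat) :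
  convex_function (`[1, +oo[%classic : set R) g -> (1 <= i)%N ->
  g i.+1%:R + g i.+1%:R <= g i%:R + g i.+2%:R.
Proof.
move=> cg i1.
have half01 : 0 <= (1 / 2 : R) <= 1 by lra.
have mem m : (1 <= m)%N -> (m%:R : R) \in (`[1, +oo[%classic : set R).
  by move=> m1; rewrite inE /= in_itv /= andbT ler1n.
have := cg (Itv01 (proj1 (andP half01)) (proj2 (andP half01))) _ _ (mem i i1) (mem i.+2 isT).
set mid := (X in g X).
have -> : mid = i.+1%:R.
  (* The abstract convex combination with weight [1 / 2] unfolds to this expression by
     conversion. *)
  transitivity (1 / 2 * i%:R + (1 - 1 / 2) * i.+2%:R : R); first by [].
  by rewrite -[i.+2%:R]natr1 -[i.+1%:R]natr1; lra.
rewrite convRE /= /unstable.onem; lra.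
Qed.

(** * Degrees in unicyclic graphs *)

Section Cycles.
Variables (T : eqType) (c : seq T).
Hypotheses (c_uniq : uniq c) (c_size : (3 <= size c)%N).

Lemma next_neq_prev z : z \in c -> next c z != prev c z.
Proof.
move=> zc; have [i s ec] := rot_to zc.
(* After rotating [z] to the front, its successor is the second entry and its predecessor the last
   one; these differ as there are at least three entries. *)
rewrite -(next_rot i c_uniq) -(prev_rot i c_uniq) ec.
move: (c_uniq) (c_size); rewrite -(rot_uniq i) -(size_rot i) ec.
case: s {ec} => [|a [|b s]] //= /and4P[zabs abs _ _] _.
move: zabs abs; rewrite !inE !eqxx !negb_or => /and3P[za zb zs] /andP[ab as_].
rewrite (negPf za) (negPf zb).
have -> : prev_at z z b s = last b s.
  elim: s b {zb as_ ab} zs => [|b' s IH] b /=; first by rewrite eqxx.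
  by rewrite inE negb_or => /andP[/negPf-> /IH->].
by apply: contraTneq (mem_last b s) => <-; rewrite inE negb_or ab.
Qed.

End Cycles.

Lemma uniq_three_subset (T : finType) (c : seq T) (A : {pred T}) :
  uniq c -> (3 <= size c)%N -> {subset c <= A} ->
  exists2 B : {set T}, #|B| = 3%N & B \subset A.
Proof.
move=> cu cs cA; exists [set z in take 3 c].
  by rewrite cardsE (card_uniqP _) ?take_uniq // size_take_min; exact/minn_idPl.
by apply/fintype.subsetP=> z; rewrite inE => /mem_take/cA.
Qed.

Lemma deg_cycle_ge2 (G : graph) (c : seq G) z :
  ucycle (@adj G) c -> (3 <= size c)%N -> z \in c -> (2 <= deg z)%N.
Proof.
move=> /andP[cc cu] cs zc.
have <- : #|[set next c z; prev c z]| = 2%N by rewrite cards2 next_neq_prev.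
apply/subset_leq_card/fintype.subsetP=> v; rewrite !inE => /orP[]/eqP->.
  exact: next_cycle cc zc.
by rewrite adj_sym; exact: prev_cycle cc zc.
Qed.

Lemma deg_gt0 (G : graph) (u : G) : (1 < #|G|)%N -> (0 < deg u)%N.
Proof.
move=> G1; have [v vu] : exists v, v != u.
  apply/existsP; rewrite -negb_forall; apply/negP=> /forallP eu.
  suff : (#|G| <= 1)%N by rewrite leqNgt G1.
  by apply/fintype_le1P => x y; rewrite (eqP (eu x)) (eqP (eu y)).
have /connectP[[|w s] /= ps ev] := adj_connected u v.
  by rewrite ev eqxx in vu.
by apply/card_gt0P; exists w; rewrite inE; case/andP: ps.
Qed.

(** Take [d] to be the distance from [r]: the last but one vertex of a shortest path to [x] is a
    neighbour of [x] closer to [r]. *)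
Lemma rooted_parent (G : graph) (r : G) :
  exists (p : G -> G) (d : G -> nat),
    forall x, x != r -> adj x (p x) && (d (p x) < d x)%N.
Proof.
pose reach x k := [exists s : k.-tuple G, path (@adj G) r s && (last r s == x)].
have ex x : exists k, reach x k.
  have /connectP[s ps ->] := adj_connected r x.
  by exists (size s); apply/existsP; exists (in_tuple s); rewrite ps eqxx.
pose d x := ex_minn (ex x).
(* The default [x] can only be returned at the root; elsewhere the search is shown to succeed. *)
exists (fun x => odflt x [pick z | adj x z && (d z < d x)%N]), d => x xr.
case: pickP => //=; rewrite /d.
case: (ex_minnP (ex x)) => k /existsP[[s /= sk]].
case/lastP: s sk => [|s y] sk /=.
  by rewrite eq_sym (negPf xr).
rewrite rcons_path last_rcons => /andP[/andP[ps sy] /eqP eyx] _ /(_ (last r s)).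
rewrite adj_sym -eyx sy /=; case: ex_minnP => m _ /(_ (size s)) mle /negP[].
move/eqP: sk => <-; rewrite size_rcons ltnS; apply: mle.
by apply/existsP; exists (in_tuple s); rewrite /= ps eqxx.
Qed.

(** * Spanning trees and fundamental cycles *)

Section SpanningTree.
Variables (G : graph) (r : G) (p : G -> G) (d : G -> nat).
Hypothesis parentP : forall x, x != r -> adj x (p x) && (d (p x) < d x)%N.

(** The guards exclude the root, where the value of [p] is arbitrary. *)
Definition tree : rel G :=
  fun u v => ((u != r) && (p u == v)) || ((v != r) && (p v == u)).

Lemma tree_sym : symmetric tree.
Proof. by move=> u v; rewrite /tree orbC. Qed.

Lemma tree_adj u v : tree u v -> adj u v.
Proof.
case/orP=> /andP[/parentP/andP[a _] /eqP<-] //; by rewrite adj_sym.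
Qed.

Lemma tree_connected x y : connect tree x y.
Proof.
have to_r z : connect tree z r.
  have [m] := ubnP (d z); elim: m z => // m IH z; rewrite ltnS => dz.
  have [->|zr] := eqVneq z r; first exact: connect0.
  have /andP[_ dp] := parentP zr.
  apply: (connect_trans (connect1 _) (IH (p z) (leq_trans dp dz))).
  by rewrite /tree zr eqxx.
apply: (connect_trans (to_r x)).
by rewrite (sym_connect_sym tree_sym) to_r.
Qed.

(* At a deepest vertex of a cycle both neighbours would be its parent. *)
Lemma cycle_not_tree c :
  uniq c -> (3 <= size c)%N -> ~~ cycle tree c.
Proof.
move=> cu cs; apply/negP=> cc.
have [z0 z0c] : exists z, z \in c.
  by case: c cs {cu cc} => // z0 s _; exists z0; rewrite mem_head.
case: (@arg_maxnP _ z0 (mem c) d z0c) => z zc zmax.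
have up w : w \in c -> tree z w -> w = p z.
  move=> wc /orP[/andP[_ /eqP->] //|/andP[wr /eqP pw]].
  have /andP[_] := parentP wr; rewrite pw => lt.
  by have := zmax w wc; rewrite /= leqNgt lt.
have := next_neq_prev cu cs zc.
rewrite (up (next c z)) ?mem_next ?(next_cycle cc) //.
by rewrite (up (prev c z)) ?mem_prev ?eqxx // tree_sym (prev_cycle cc).
Qed.

(** A simple tree path from [x] to [y] is closed up by the edge from [y] back to [x]. *)
Lemma fundamental_cycle x y : adj x y -> ~~ tree x y ->
  exists c : seq G,
    [/\ ucycle (@adj G) c, (3 <= size c)%N, [set x; y] \in cycle_edges c
      & forall a b, [set a; b] \in cycle_edges c ->
          tree a b \/ [set a; b] = [set x; y]].
Proof.
move=> axy ntxy.
have xy : x != y by apply: contraTneq axy => ->; rewrite adj_irrefl.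
have /connectP[s0 ps0 ey0] := tree_connected x y.
case: (shortenP ps0) ey0 => s ps us _ ey {s0 ps0}.
case/lastP: s ps us ey => [|s y'] ps us; first by move=> e; rewrite e eqxx in xy.
rewrite last_rcons => e; move: ps us; rewrite -{y'}e => ps us.
have yc : y \in y :: x :: s by rewrite mem_head.
have nxt : next (y :: x :: s) y = x by rewrite /= eqxx.
(* Adding only the directed pair from [y] to [x] to the tree makes the whole list a cycle of [e'],
   so each of its steps is a tree edge or the closing one. *)
pose e' : rel G := [rel a b | tree a b || ((a == y) && (b == x))].
have ce' : cycle e' (y :: x :: s).
  by rewrite /= {1}/e' /= !eqxx orbT /=; apply: sub_path ps => a b tab; rewrite /e' /= tab.
exists (y :: x :: s); split.
- apply/andP; split.
    apply: sub_cycle ce' => a b /orP[/tree_adj //|/andP[/eqP-> /eqP->]].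
    by rewrite adj_sym.
  move: us; rewrite /= mem_rcons rcons_uniq !inE !negb_or.
  by case/andP=> /andP[_ ->] /andP[-> ->]; rewrite eq_sym xy.
(* With [s] empty the path would be the single edge from [x] to [y], which is not in the tree. *)
- by case: s ps {us ce' nxt yc} => //=; rewrite andbT (negPf ntxy).
- by apply/imsetP; exists y; rewrite // nxt finset.setUC.
- move=> a b /imsetP[z zc eab].
  have [|/andP[/eqP ez /eqP en]] := orP (next_cycle ce' zc); last first.
    by right; rewrite eab ez nxt finset.setUC.
  move=> tz; left.
  (* An equality of two-element sets determines [a] and [b] up to order, and [tree] is symmetric. *)
  have : a \in [set z; next (y :: x :: s) z] by rewrite -eab set21.
  have : b \in [set z; next (y :: x :: s) z] by rewrite -eab set22.
  have nz : z != next (y :: x :: s) z.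
    by apply: contraTneq (tree_adj tz) => <-; rewrite adj_irrefl.
  have ab : a != b.
    apply: contraNneq nz => e; rewrite e finset.setUid in eab.
    have := set21 z (next (y :: x :: s) z); have := set22 z (next (y :: x :: s) z).
    by rewrite -!eab !inE => /eqP-> /eqP->.
  rewrite !inE => /orP[]/eqP eb /orP[]/eqP ea; move: ab tz;
    rewrite ea eb ?eqxx // => _ //; by rewrite tree_sym.
Qed.

(** Each vertex other than the root accounts for one edge to its parent, counted in both
    orientations. *)
Lemma sum_tree : (\sum_u \sum_v tree u v = (#|G|.-1).*2)%N.
Proof.
have half : (\sum_u \sum_v ((u != r) && (p u == v)) = #|G|.-1)%N.
  transitivity (\sum_(u in predC1 r) 1)%N; last by rewrite sum1_card cardC1.
  rewrite [RHS]big_mkcond; apply: eq_bigr => u _; rewrite inE.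
  case: (u != r) => /=; last by rewrite big1.
  rewrite (bigD1 (p u)) //= eqxx big1 // => v; by rewrite eq_sym => /negPf->.
rewrite -addnn -{1}half -[in X in (_ + X)%N]half.
rewrite [X in (_ + X)%N]exchange_big -big_split; apply: eq_bigr => u _.
rewrite -big_split; apply: eq_bigr => v _ /=; rewrite /tree.
have [/andP[ur /eqP pu]|] := boolP ((u != r) && (p u == v)) => //=.
have [/andP[vr /eqP pv]|] := boolP ((v != r) && (p v == u)) => //=.
(* Two vertices cannot be parents of each other, since [d] strictly decreases; no ordered pair is
   counted twice. *)
have := parentP ur; have := parentP vr; rewrite pu pv.
by case/andP=> _ lt /andP[_ /(ltn_trans lt)]; rewrite ltnn.
Qed.

End SpanningTree.

Lemma sum_deg_unicyclic (G : graph) :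
  unicyclic G -> (\sum_(u : G) deg u = #|G|.*2)%N.
Proof.
case=> C [[c [/andP[cc cu] cs eC]] uniqC].
have [r _] := adj_nonempty G.
have G0 : (0 < #|G|)%N by apply/card_gt0P; exists r.
have [p [d par]] := rooted_parent r.
have [x [y [axy ntxy]]] : exists x y, adj x y /\ ~~ tree r p x y.
  apply: contrapT => nex; have /negP[] := cycle_not_tree par cu cs.
  apply: sub_cycle cc => a b ab; apply: contrapT => /negP nt; apply: nex.
  by exists a, b.
have xy : x != y by apply: contraTneq axy => ->; rewrite adj_irrefl.
(* Both fundamental cycles have the edge set [C], so the edge [ab] occurs in the cycle of [xy],
   whose only edge outside the tree is [xy]. *)
have edges a b : adj a b -> ~~ tree r p a b -> [set a; b] = [set x; y].
  move=> ab ntab.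
  have [c1 [uc1 sc1 _ in1]] := fundamental_cycle par axy ntxy.
  have [c2 [uc2 sc2 m2 _]] := fundamental_cycle par ab ntab.
  have e1 : C = cycle_edges c1 by apply: uniqC; exists c1.
  have e2 : C = cycle_edges c2 by apply: uniqC; exists c2.
  by case: (in1 a b) => //; [rewrite -e1 e2 | rewrite (negPf ntab)].
(* Read as a number, adjacency is the tree plus both orientations of the missed edge; summation
   gives [2 (n - 1) + 2]. *)
have split_adj u v : adj u v =
    (tree r p u v + ((u == x) && (v == y)) + ((u == y) && (v == x)))%N :> nat.
  have [tuv|ntuv] /= := boolP (tree r p u v).
    rewrite (tree_adj par tuv).
    have -> : (u == x) && (v == y) = false.
      by apply: contraNF ntxy => /andP[/eqP<- /eqP<-].
    have -> // : (u == y) && (v == x) = false.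
    by apply: contraNF ntxy => /andP[/eqP<- /eqP<-]; rewrite tree_sym.
  have [auv|nauv] := boolP (adj u v).
    have e := edges u v auv ntuv.
    have uv : u != v by apply: contraTneq auv => ->; rewrite adj_irrefl.
    have := set21 u v; have := set22 u v; rewrite e !inE.
    move=> /orP[]/eqP ev /orP[]/eqP eu; move: uv; rewrite eu ev ?eqxx //= => _.
      by rewrite !(eq_sym y) (negPf xy).
    by rewrite (negPf xy).
  have -> : (u == x) && (v == y) = false.
    by apply: contraNF nauv => /andP[/eqP-> /eqP->].
  have -> // : (u == y) && (v == x) = false.
  by apply: contraNF nauv => /andP[/eqP-> /eqP->]; rewrite adj_sym.
have one (a b : G) : (\sum_u \sum_v ((u == a) && (v == b)) = 1)%N.
  rewrite (bigD1 a) //= [X in (_ + X)%N]big1 ?addn0.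
    rewrite (bigD1 b) //= !eqxx big1 // => v /negPf->; by rewrite andbF.
  by move=> u /negPf->; rewrite big1.
transitivity (\sum_(u : G) \sum_(v : G) adj u v)%N.
  apply: eq_bigr => u _; rewrite /deg -sum1dep_card big_mkcond /=.
  by apply: eq_bigr => v _; case: adj.
under eq_bigr => u _ do under eq_bigr => v _ do rewrite split_adj.
under eq_bigr => u _ do rewrite !big_split /=.
by rewrite !big_split /= !one (sum_tree par) !addn1 -doubleS prednK.
Qed.

(** * The extremal graphs *)

Lemma cycle_neighbours (G : graph) (c c' : seq G) z :
  ucycle (@adj G) c' -> (3 <= size c')%N -> {subset c' <= c} -> z \in c' ->
  (#|[set v in c | adj z v]| <= 2)%N ->
  [set v in c | adj z v] = [set next c' z; prev c' z].
Proof.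
move=> /andP[cc cu] cs cc' zc card2; apply/esym/eqP.
rewrite eqEcard cards2 next_neq_prev // card2 andbT.
apply/fintype.subsetP=> v; rewrite !inE => /orP[]/eqP->.
  by rewrite cc' ?mem_next ?(next_cycle cc).
by rewrite cc' ?mem_prev // adj_sym (prev_cycle cc).
Qed.

Lemma cycle_edges_sub (G : graph) (c1 c2 : seq G) :
  uniq c2 -> {subset c1 <= c2} ->
  (forall z, z \in c1 -> next c1 z \in [set next c2 z; prev c2 z]) ->
  cycle_edges c1 \subset cycle_edges c2.
Proof.
move=> u2 sub nb; apply/fintype.subsetP=> e /imsetP[z zc ->].
have := nb z zc; rewrite !inE => /orP[]/eqP->.
  by apply/imsetP; exists z; rewrite ?sub.
by apply/imsetP; exists (prev c2 z); rewrite ?mem_prev ?sub ?next_prev // finset.setUC.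
Qed.

(** Criterion for both extremal graphs: along [c] and along any cycle [c'] inside it, the two
    neighbours of a vertex of [c'] are all its neighbours in [c], so both cycles use the same
    edges. *)
Lemma unicyclic_chordless (G : graph) (c : seq G) :
  ucycle (@adj G) c -> (3 <= size c)%N ->
  (forall c' : seq G, ucycle (@adj G) c' -> (3 <= size c')%N ->
     {subset c' <= c}) ->
  (forall z, z \in c -> (#|[set v in c | adj z v]| <= 2)%N) ->
  unicyclic G.
Proof.
move=> uc cs sub nb; exists (cycle_edges c); split; first by exists c.
move=> _ [c' [uc' cs' ->]]; have c'c := sub c' uc' cs'.
have N' z (zc' : z \in c') := cycle_neighbours uc' cs' c'c zc' (nb z (c'c z zc')).
have N z (zc : z \in c) := cycle_neighbours uc cs (fun _ => id) zc (nb z zc).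
have cu := ucycle_uniq uc; have cu' := ucycle_uniq uc'.
(* Walking along [c] from a vertex of [c'] never leaves [c']. *)
have cc' : {subset c <= c'}.
  move=> w wc.
  have [z zc'] : exists z, z \in c'.
    by case: c' cs' {uc' sub c'c N' cu'} => // z s _; exists z; rewrite mem_head.
  have := connect_cycle (cycle_next cu) (c'c z zc') wc.
  move/iter_findex <-; elim: findex => //= k IH.
  have : next c (iter k (next c) z) \in [set v in c | adj (iter k (next c) z) v].
    by rewrite N ?c'c // set21.
  by rewrite N' // !inE => /orP[]/eqP->; rewrite ?mem_next ?mem_prev.
apply/eqP; rewrite finset.eqEsubset; apply/andP; split; apply: cycle_edges_sub => // z zc.
  by rewrite -N' ?cc' // N // set21.
by rewrite -N ?c'c // N' // set21.
Qed.

(** * The cycle on [m + 3] vertices *)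

Section CycleGraph.
Variable m : nat.
Implicit Types i j : 'I_m.+3.

Lemma ordS_neq i : ordS i != i.
Proof.
rewrite -val_eqE /= -[X in _ != X](modn_small (ltn_ord i)).
by rewrite -addn1 -[X in _ != X %[mod _]]addn0 eqn_modDl modn_small.
Qed.

(** 2 is not 0 modulo [m + 3]; hence the successor and the predecessor of a vertex are distinct. *)
Lemma ordS_ordS_neq i : ordS (ordS i) != i.
Proof.
rewrite -val_eqE /= -[X in _ != X](modn_small (ltn_ord i)).
rewrite -addn1 modnDml -addn1 -addnA -[X in _ != X %[mod _]]addn0.
by rewrite eqn_modDl modn_small.
Qed.

Definition ring_adj : rel 'I_m.+3 := fun i j => (ordS i == j) || (ordS j == i).

Lemma ring_adj_sym : symmetric ring_adj.
Proof. by move=> i j; rewrite /ring_adj orbC. Qed.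

Lemma ring_adj_irrefl : irreflexive ring_adj.
Proof. by move=> i; rewrite /ring_adj orbb (negPf (ordS_neq i)). Qed.

Lemma fconnect_ordS0 i : fconnect (@ordS m.+3) ord0 i.
Proof.
suff <- : iter i (@ordS m.+3) ord0 = i by exact: fconnect_iter.
apply: val_inj; case: i => k /=; elim: k => //= k IH ltk.
by rewrite IH ?modn_small // ltnW.
Qed.

Lemma ring_adj_connected i j : connect ring_adj i j.
Proof.
have from0 k : connect ring_adj ord0 k.
  apply: connect_sub (fconnect_ordS0 k) => u v /= uv.
  by apply: connect1; rewrite /ring_adj uv.
apply: connect_trans (from0 j).
by rewrite (sym_connect_sym ring_adj_sym).
Qed.

Lemma ring_adj_nonempty : exists i j, ring_adj i j.
Proof. by exists ord0, (ordS ord0); rewrite /ring_adj eqxx. Qed.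

Definition cycle_graph : graph :=
  Graph ring_adj_sym ring_adj_irrefl ring_adj_connected ring_adj_nonempty.

Lemma deg_cycle_graph (u : cycle_graph) : deg u = 2%N.
Proof.
transitivity #|[set ordS u; ord_pred u]|; last first.
  rewrite cards2; case: eqP => // e.
  by have := ordS_ordS_neq u; rewrite e ord_predK eqxx.
apply: eq_card => v; rewrite !inE /= /ring_adj ![_ == v]eq_sym.
by rewrite (can2_eq (@ordSK _) (@ord_predK _)).
Qed.

Lemma unicyclic_cycle_graph : unicyclic cycle_graph.
Proof.
pose c : seq cycle_graph := orbit (@ordS m.+3) ord0.
have memc v : v \in c by rewrite -fconnect_orbit fconnect_ordS0.
apply: (@unicyclic_chordless _ c).
- apply/andP; split; last exact: orbit_uniq.
  apply: sub_cycle (cycle_orbit (@ordS_inj _) ord0) => u v /= uv.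
  by rewrite /ring_adj uv.
- rewrite -(card_uniqP (orbit_uniq _ _)).
  by rewrite (eq_card (B := predT)) ?card_ord // => v; rewrite memc.
- by move=> c' _ _ z _; exact: memc.
- move=> z _; apply: leq_trans (eq_leq (deg_cycle_graph z)).
  by apply/subset_leq_card/fintype.subsetP=> v; rewrite !inE => /andP[].
Qed.

End CycleGraph.

(** * The star on [m + 4] vertices with one additional edge *)

Section StarWithEdge.
Variable m : nat.
Implicit Types i j : 'I_m.+4.

(** Vertex 0 is the centre; the last disjunct adds just the edge between 1 and 2. *)
Definition star_edge_adj : rel 'I_m.+4 := fun i j =>
  (i != j) && [|| val i == 0, val j == 0 | (val i <= 2) && (val j <= 2)]%N.

Lemma star_edge_adj_sym : symmetric star_edge_adj.
Proof.
by move=> i j; rewrite /star_edge_adj eq_sym orbCA [((val j <= 2) && _)%N]andbC.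
Qed.

Lemma star_edge_adj_irrefl : irreflexive star_edge_adj.
Proof. by move=> i; rewrite /star_edge_adj eqxx. Qed.

Lemma star_edge_adj_connected i j : connect star_edge_adj i j.
Proof.
have from0 k : connect star_edge_adj ord0 k.
  have [<-|k0] := eqVneq ord0 k; first exact: connect0.
  by apply: connect1; rewrite /star_edge_adj k0.
apply: connect_trans (from0 j).
by rewrite (sym_connect_sym star_edge_adj_sym).
Qed.

Let v0 : 'I_m.+4 := @Ordinal m.+4 0 isT.
Let v1 : 'I_m.+4 := @Ordinal m.+4 1 isT.
Let v2 : 'I_m.+4 := @Ordinal m.+4 2 isT.

Lemma star_edge_adj_nonempty : exists i j, star_edge_adj i j.
Proof. by exists v0, v1. Qed.

Definition star_edge : graph :=
  Graph star_edge_adj_sym star_edge_adj_irrefl star_edge_adj_connected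
    star_edge_adj_nonempty.

Lemma deg_star_edge (u : star_edge) :
  deg u = if val u is 0 then m.+3 else if (val u <= 2)%N then 2%N else 1%N.
Proof.
case: u => -[|[|[|u]]] lu /=.
- transitivity #|predC1 v0|; last by rewrite cardC1 card_ord.
  by apply: eq_card => v; rewrite !inE /= /star_edge_adj -!val_eqE /=; lia.
- transitivity #|[set v0; v2]|; last by rewrite cards2.
  by apply: eq_card => v; rewrite !inE /= /star_edge_adj -!val_eqE /=; lia.
- transitivity #|[set v0; v1]|; last by rewrite cards2.
  by apply: eq_card => v; rewrite !inE /= /star_edge_adj -!val_eqE /=; lia.
- transitivity #|[set v0]|; last by rewrite cards1.
  by apply: eq_card => v; rewrite !inE /= /star_edge_adj -!val_eqE /=; lia.
Qed.

Lemma unicyclic_star_edge : unicyclic star_edge.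
Proof.
have memc (v : star_edge) : (v \in [:: v0; v1; v2]) = (val v <= 2)%N.
  by rewrite !inE -!val_eqE /=; lia.
apply: (@unicyclic_chordless _ ([:: v0; v1; v2] : seq star_edge)) => //.
(* Vertices on a cycle have degree at least 2, which leaves only those of the triangle. *)
- move=> c uc cs z zc; rewrite memc.
  have := deg_cycle_ge2 uc cs zc; rewrite deg_star_edge.
  by case: (val z) => // k; case: ifP.
- move=> z zc; apply: leq_trans (_ : #|[set v0; v1; v2] :\ z| <= _)%N.
    apply/subset_leq_card/fintype.subsetP=> v.
    rewrite finset.in_set memc !inE /= /star_edge_adj -!val_eqE /=; lia.
  have card3 : (#|[set v0; v1; v2]| <= 3)%N.
    by apply: leq_trans (leq_card_setU _ _).1 _; rewrite cards2 cards1.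
  rewrite -ltnS; apply: leq_trans card3.
  rewrite (cardsD1 z [set v0; v1; v2]) (_ : z \in _) //.
  by move: zc; rewrite memc !inE -!val_eqE /=; lia.
Qed.

Lemma II_star_edge (R : realType) (f : R -> R) :
  II f star_edge = f m.+3%:R * f 2 ^+ 2 * f 1 ^+ m.+1.
Proof.
rewrite /II; under eq_bigr => u _ do rewrite deg_star_edge.
rewrite expr2 3!big_ord_recl /= !mulrA; congr (_ * _).
by rewrite prodr_const card_ord.
Qed.

End StarWithEdge.

Theorem theorem3p6 (R : realType) (n : nat) (f : R -> R)
    (n_ge4 : (4 <= n)%N)
    (f_gt0 : forall x : R, 1 <= x -> 0 < f x)
    (lnf_convex :
       convex_function (`[1, +oo[%classic : set R) (fun x : R => ln (f x))) :
  [/\ forall G : graph, #|G| = n -> unicyclic G ->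
        f 2 ^+ n <= II f G <= f (n - 1)%:R * f 2 ^+ 2 * f 1 ^+ (n - 3),
      exists G : graph, [/\ #|G| = n, unicyclic G & II f G = f 2 ^+ n]
    & exists G : graph, [/\ #|G| = n, unicyclic G
        & II f G = f (n - 1)%:R * f 2 ^+ 2 * f 1 ^+ (n - 3)]].
Proof.
case: n n_ge4 => [|[|[|[|m]]]] // _; split; last first.
- exists (star_edge m); rewrite card_ord; split=> //; first exact: unicyclic_star_edge.
  by rewrite II_star_edge subn1 subSS subn2.
(* Here [n = m + 4], whereas [cycle_graph k] has [k + 3] vertices. *)
- exists (cycle_graph m.+1); rewrite card_ord; split=> //; first exact: unicyclic_cycle_graph.
  rewrite /II; under eq_bigr => u _ do rewrite deg_cycle_graph.
  by rewrite prodr_const card_ord.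
move=> G cardG uniG.
pose h (k : nat) : R := ln (f k%:R).
have h_convex i : (1 <= i)%N -> h i.+1 + h i.+1 <= h i + h i.+2.
  exact: (convex_function_midpoint lnf_convex).
have expRh k : (1 <= k)%N -> expR (h k) = f k%:R.
  by move=> k1; rewrite lnK // posrE f_gt0 // ler1n.
have deg1 (u : G) : (1 <= deg u)%N by apply: deg_gt0; rewrite cardG.
have sumdeg := sum_deg_unicyclic uniG.
have -> : II f G = expR (\sum_(u : G) h (deg u)).
  by rewrite expR_sum; apply: eq_bigr => u _; rewrite expRh.
apply/andP; split.
  rewrite -(expRh 2%N) // -expRM_natl ler_expR mulr_natl -cardG.
  exact: convex_seq_sum_lower.
have [C [[c [uc cs _]] _]] := uniG.
have [B cardB /fintype.subsetP subB] : exists2 B : {set G}, #|B| = 3%N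
    & B \subset [pred u | 2 <= deg u]%N.
  apply: (uniq_three_subset (ucycle_uniq uc) cs) => z zc.
  exact: deg_cycle_ge2 uc cs zc.
(* This is the sequence (2, 2, 2, 1, ..., 1), with the 2s at three vertices of the cycle. *)
pose e (u : G) := (1 + (u \in B))%N.
have sum_e : (\sum_u e u = m.+4 + 3)%N.
  rewrite big_split sum1_card cardG -cardB -[X in _ = (_ + X)%N]sum1_card.
  by rewrite [X in _ = (_ + X)%N]big_mkcond; congr addn;
    apply: eq_bigr => u _; case: (u \in B).
have e_deg u : (e u + (deg u - e u) = deg u)%N.
  apply: subnKC; rewrite /e; by case: (boolP (u \in B)) => [/subB|_].
(* The total excess is [2n - (n + 3) = n - 3]. *)
have sum_k : (\sum_u (deg u - e u) = m.+1)%N.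
  have : (\sum_u (e u + (deg u - e u)) = m.+4.*2)%N.
    by rewrite -cardG -sumdeg; apply: eq_bigr.
  rewrite big_split /= sum_e; lia.
have sum_h : \sum_u h (e u) = h 2%N *+ 3 + h 1%N *+ m.+1.
  rewrite (bigID (mem B)) /=; congr (_ + _).
    rewrite -cardB -sumr_const; apply: eq_bigr => u uB; by rewrite /e uB.
  have <- : #|[predC B]| = m.+1 by have := cardC B; rewrite cardB cardG; lia.
  rewrite -sumr_const; apply: eq_bigr => u uB; by rewrite /e (negPf uB).
have e12 u : (1 <= e u <= 2)%N by rewrite /e; case: (u \in B).
have := convex_seq_sum_upper h_convex (fun u => (deg u - e u)%N) e12.
rewrite sum_h sum_k; under eq_bigr do rewrite e_deg.
move=> ub.
(* The transfer ends at [2 + (n - 3) = n - 1]; the [h 2] on the left of [ub] cancels one of the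
   three on the right. *)
rewrite subn1 /= subSS subn2 /= -(expRh m.+3) // -(expRh 2%N) // -(expRh 1%N) //.
rewrite -!expRM_natl -!expRD ler_expR !mulr_natl.
move: ub; rewrite !mulrS; lra.
Qed.
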